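(* Let $(X,d_X)$ be a finite metric space, let $\mathsf{Y}$ be a class of finite metric spaces and let $D\ge1$. If $(X,d_X)$ admits a stochastic $D$-embedding into dominating $\mathsf{Y}$-metrics, then $\mathsf{La}(X)$ embeds bi-Lipschitzly into $L_1$ with distortion at most $D\cdot \sup_{Y\in\mathsf{Y}}c_1(\mathsf{Ts}(Y))$.
   Context: For a finite metric space $(X,d_X)$, points $x,y\in X$ and $C\subset X$, $\mathrm{tsp}_X(x,C,y)$ is the minimum of $\sum_{i=1}^n d_X(x_{i-1},x_i)$ over all finite sequences $x_0,\dots,x_n$ ($n\ge0$) in $X$ with $x_0=x$, $x_n=y$, $C\subset\{x_0,\dots,x_n\}$. Let $[X]^{<\omega}$ be the set of finite subsets of $X$ and $\triangle$ the symmetric difference. On $[X]^{<\omega}\times X$ define $\tau_X((A,x),(B,y))=\mathrm{tsp}_X(x,A\triangle B,y)$ (a semi-metric) and $d_{\mathsf{La}(X)}((A,x),(B,y))=\mathrm{tsp}_X(x,A\triangle B,y)+|A\triangle B|$ (a metric). Then $\mathsf{Ts}(X)=([X]^{<\omega}\times X,\tau_X)$ and the lamplighter metric space over $X$ is $\mathsf{La}(X)=([X]^{<\omega}\times X,d_{\mathsf{La}(X)})$. Stochastic embeddings: $(X,d_X)$ admits a stochastic $D$-embedding into dominating $\mathsf{Y}$-metrics if there exist $k\ge 1$, non-negative numbers $p_1,\dots,p_k$ with $\sum_{i=1}^k p_i=1$, and maps $f_i\colon X\to (Y_i,d_i)\in\mathsf{Y}$ such that for all $x,y\in X$: $d_i(f_i(x),f_i(y))\ge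 d_X(x,y)$ for all $1\le i\le k$, and $\sum_{i=1}^k p_i d_i(f_i(x),f_i(y))\le D\,d_X(x,y)$. A (semi-)metric space $(M,d_M)$ embeds bi-Lipschitzly into $L_1$ with distortion at most $D'$ if there are $s>0$ and a map $f\colon M\to L_1$ with $s\,d_M(x,y)\le\|f(x)-f(y)\|_1\le D's\,d_M(x,y)$ for all $x,y\in M$; $c_1(M)$ (the $L_1$-distortion) is the infimum of such constants $D'\geq 1$. *)

(* Defs.v *)
From HB Require Import structures.
From mathcomp Require Import all_boot all_order all_algebra.
From mathcomp Require Import all_classical all_reals all_analysis.

Set Implicit Arguments.
Unset Strict Implicit.
Unset Printing Implicit Defensive.

Import Order.TTheory GRing.Theory Num.Theory.

Local Open Scope classical_set_scope.
Local Open Scope ring_scope.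

#[short(type="finMetricType")]
HB.structure Definition FinMetric (R : numDomainType) :=
  { M of Metric R M & Finite M }.

Section Tsp.
Context {R : realType} {X : finMetricType R}.

(* The sequence x_0, ..., x_n is encoded as x :: s with x_0 = x and n = size s,
   so that it is never empty and n = 0 is allowed. *)
Definition walk_length (x : X) (s : seq X) : R :=
  \sum_(i < size s) mdist (nth x (x :: s) i) (nth x (x :: s) i.+1).

Definition is_tour (x : X) (C : {set X}) (y : X) (s : seq X) : Prop :=
  last x s = y /\ C \subset x :: s.

(* This infimum is attained: see tsp_min. *)
Definition tsp (x : X) (C : {set X}) (y : X) : R :=
  inf [set walk_length x s | s in is_tour x C y].

Lemma walk_length_ge0 (x : X) (s : seq X) : 0 <= walk_length x s.
Proof. by apply: sumr_ge0 => i _; exact: mdist_ge0. Qed.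

Lemma walk_length_cons (x z : X) (s : seq X) :
  walk_length x (z :: s) = mdist x z + walk_length z s.
Proof.
rewrite /walk_length big_ord_recl; congr (_ + _).
apply: eq_bigr => i _; rewrite !lift0 /=.
by congr mdist; apply: set_nth_default; rewrite /= ?ltnS ?(ltnW (ltn_ord i)).
Qed.

Lemma walk_length_cat (x : X) (s t : seq X) :
  walk_length x (s ++ t) = walk_length x s + walk_length (last x s) t.
Proof.
elim: s x => [|z s IH] x /=; first by rewrite {2}/walk_length big_ord0 add0r.
by rewrite !walk_length_cons IH addrA.
Qed.

Lemma mdist_walk (x : X) (s : seq X) : mdist x (last x s) <= walk_length x s.
Proof.
elim: s x => [|z s IH] x /=; first by rewrite mdistxx walk_length_ge0.
rewrite walk_length_cons; apply: le_trans (metric_triangle x z _) _.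
by rewrite lerD2l.
Qed.

Lemma is_tour_short (x : X) (C : {set X}) (y : X) (s : seq X) :
  is_tour x C y s -> exists s', [/\ is_tour x C y s',
    (size s' <= #|X|.+1)%N & walk_length x s' <= walk_length x s].
Proof.
have [n] := ubnP (size s); elim: n s => // n IH s.
rewrite ltnS => sn st.
have [short|long] := leqP (size s) #|X|.+1; first by exists s; split.
move: st => [lasty /fintype.subsetP sub].
case/lastP: s sn lasty sub long => [|s w] sn lasty sub long; first by [].
rewrite last_rcons in lasty; rewrite size_rcons ltnS in long.
have nuniq : ~~ uniq s.
  apply/negP => us; move: (max_card (mem s)); rewrite (card_uniqP us).
  by rewrite leqNgt long.
have [s1 [s2 [z [es z2]]]] : exists s1 s2 z, s = s1 ++ z :: s2 /\ z \in s2.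
  elim: s nuniq {sn sub long} => //= a s IHs.
  rewrite negb_and negbK => /orP[as_|/IHs [s1 [s2 [z [-> zs]]]]].
    by exists [::], s, a.
  by exists (a :: s1), s2, z.
have [||s' [tour' size' len']] := IH (s1 ++ rcons s2 w).
- apply: leq_trans sn; rewrite es !(size_cat, size_rcons, size_rcons) /=.
  by rewrite !addnS !ltnS.
- split; first by rewrite last_cat last_rcons.
  apply/fintype.subsetP => c /sub.
  rewrite es rcons_cat /= !(inE, mem_cat, mem_rcons).
  by case: (eqVneq c z) => [->|_]; rewrite ?z2 ?orbT.
exists s'; split => //; apply: le_trans len' _.
rewrite es rcons_cat !walk_length_cat lerD2l rcons_cons.
case: s2 z2 {es} => // b s2 _; rewrite rcons_cons !walk_length_cons addrA.
by rewrite lerD2r metric_triangle.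
Qed.

Lemma tsp_min (x : X) (C : {set X}) (y : X) :
  (exists2 s, is_tour x C y s & walk_length x s = tsp x C y) /\
  (forall s, is_tour x C y s -> tsp x C y <= walk_length x s).
Proof.
have lb s : is_tour x C y s -> tsp x C y <= walk_length x s.
  move=> st; apply: ge_inf; last by exists s.
  by exists 0 => _ [t _ <-]; exact: walk_length_ge0.
split=> //.
have tour0 : is_tour x C y (rcons (enum C) y).
  split; first by rewrite last_rcons.
  by apply/fintype.subsetP => c cC; rewrite inE mem_rcons inE mem_enum cC !orbT.
have [s0 [s0t s0n _]] := is_tour_short tour0.
pose P (t : {bseq #|X|.+1 of X}) := (last x t == y) && (C \subset x :: t).
have PP (t : {bseq #|X|.+1 of X}) : reflect (is_tour x C y t) (P t).
  by apply: (iffP andP) => -[? ?]; split => //; exact/eqP.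
have P0 : P (Bseq s0n) by apply/PP.
case: (arg_minP (fun t : {bseq #|X|.+1 of X} => walk_length x t) P0) => t Pt tmin.
exists t; first exact/PP.
apply/le_anti/andP; split; last exact/lb/PP.
apply: lb_le_inf; first by exists (walk_length x s0), s0.
move=> _ [s st <-]; have [s' [s't s'n s's]] := is_tour_short st.
by apply: le_trans s's; apply: (tmin (Bseq s'n)); apply/PP.
Qed.

End Tsp.

Definition symdiff (T : finType) (A B : {set T}) : {set T} :=
  (A :\: B) :|: (B :\: A).

(* As X is finite, {set X} is the set of all finite subsets of X.
   Ts_dist is only a semi-metric: adding x to or removing it from A leaves
   (A, x) at distance 0. *)
Definition Ts_dist (R : realType) (X : finMetricType R) (a b : {set X} * X) : R :=
  tsp a.2 (symdiff a.1 b.1) b.2.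

Definition La_dist (R : realType) (X : finMetricType R) (a b : {set X} * X) : R :=
  tsp a.2 (symdiff a.1 b.1) b.2 + #|symdiff a.1 b.1|%:R.

Definition lebesgue01 (R : realType) : {measure set (measurableTypeR R) -> \bar R} :=
  mrestr (@lebesgue_measure R) (measurable_itv `[0 : R, 1]).

Definition L1 (R : realType) := LspaceType1 (lebesgue01 R).

Definition L1_dist (R : realType) (g h : L1 R) : \bar R :=
  ('N[lebesgue01 R]_1[(fun t => (g t - h t)%:E)])%E.

Definition L1_embeds (R : realType) (M : Type) (dM : M -> M -> R) (K : R) : Prop :=
  exists (s : R) (f : M -> L1 R), 0 < s /\ forall x y,
    ((s * dM x y)%:E <= L1_dist (f x) (f y) <= (K * s * dM x y)%:E)%E.

Definition c1 (R : realType) (M : Type) (dM : M -> M -> R) : \bar R :=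
  ereal_inf [set K%:E | K in [set K : R | 1 <= K /\ L1_embeds dM K]].

(* The bound K may be +oo, in which case this asserts the existence of a
   bi-Lipschitz embedding with some finite distortion. *)
Definition L1_embeds_at_most (R : realType) (M : Type) (dM : M -> M -> R)
    (K : \bar R) : Prop :=
  exists2 K' : R, (K'%:E <= K)%E & L1_embeds dM K'.

Definition stochastic_embedding (R : realType) (X : finMetricType R)
    (Yc : set (finMetricType R)) (D : R) : Prop :=
  exists (k : nat) (p : 'I_k -> R) (Y : 'I_k -> finMetricType R)
         (f : forall i, X -> Y i),
    [/\ (1 <= k)%N,
        (forall i, 0 <= p i) /\ \sum_i p i = 1,
        forall i, Yc (Y i),
        forall i x y, mdist x y <= mdist (f i x) (f i y) &
        forall x y, \sum_i p i * mdist (f i x) (f i y) <= D * mdist x y].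

(* Main.v *)
From HB Require Import structures.
Require Import Defs.
From mathcomp Require Import all_boot all_order all_algebra.
From mathcomp Require Import all_classical all_reals all_analysis.
From mathcomp Require Import measurable_realfun.

Set Implicit Arguments.
Unset Strict Implicit.
Unset Printing Implicit Defensive.

(* Cut metrics (nonnegative combinations of cuts of a finite set) are exactly
   the metrics induced by maps into L_1: a map f into L_1 is turned into cuts by
   weighting S with the measure of the set of (t, u) with S = {x | u < f x t}.
   Since bounded cut weights form a compact set, c_1 of a finite semimetric
   space is attained, so that the constant D * sup c_1 is reached exactly.
   Given cut metrics d_i with Ts <= d_i <= K Ts on Ts(Y_i), the sum of
   the p_i d_i (pulled back along the f_i) and |A symdiff B| is one on La(X).
   The lower bound holds since a tour in Y_i can be shortened to one inside the
   image of the dominating map f_i, the upper bound by averaging the lengths of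
   the images of an optimal tour in X. If the supremum is infinite, any
   embedding of the finite metric space La(X) will do. *)

Import Order.TTheory GRing.Theory Num.Theory.
Import numFieldNormedType.Exports.

Local Open Scope classical_set_scope.
Local Open Scope ring_scope.

(** * Tours under maps between metric spaces *)

Section TspMaps.
Context {R : realType}.
Implicit Types X Y : finMetricType R.

Lemma tsp_le X (x : X) C y s : is_tour x C y s -> tsp x C y <= walk_length x s.
Proof. exact: (tsp_min x C y).2. Qed.

Lemma tsp_ge_mdist X (x : X) C y : mdist x y <= tsp x C y.
Proof.
by have [[s [<- _] <-] _] := tsp_min x C y; exact: mdist_walk.
Qed.

Lemma tsp_ge0 X (x : X) C y : 0 <= tsp x C y.
Proof. exact: le_trans (mdist_ge0 _ _) (tsp_ge_mdist _ _ _). Qed.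

Lemma tsp0 X (x : X) : tsp x finset.set0 x = 0.
Proof.
apply/le_anti; rewrite tsp_ge0 andbT.
have /tsp_le : is_tour x finset.set0 x [::].
  by split=> //; apply/fintype.subsetP => z; rewrite inE.
by rewrite /walk_length big_ord0.
Qed.

(** Here and in [walk_length_map] the edges are indexed by the same list of pairs, so that sums over
    edges and over maps can be exchanged. *)
Lemma walk_length_sum X (x : X) (s : seq X) :
  walk_length x s = \sum_(e <- zip (x :: s) s) mdist e.1 e.2.
Proof.
elim: s x => [|z s IH] x; first by rewrite /walk_length big_ord0 big_nil.
by rewrite walk_length_cons big_cons IH.
Qed.

Lemma walk_length_map X Y (f : X -> Y) x s :
  walk_length (f x) (map f s)
  = \sum_(e <- zip (x :: s) s) mdist (f e.1) (f e.2).
Proof.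
elim: s x => [|z s IH] x; first by rewrite /walk_length big_ord0 big_nil.
by rewrite walk_length_cons big_cons IH.
Qed.

Lemma is_tour_map X Y (f : X -> Y) x C y s :
  is_tour x C y s -> is_tour (f x) (f @: C) (f y) (map f s).
Proof.
move=> [<- sub]; split; first exact: last_map.
apply/fintype.subsetP => _ /imsetP[c cC ->]; rewrite -map_cons map_f//.
exact: (fintype.subsetP sub).
Qed.

Section Dominating.
Context X Y (f : X -> Y).
Hypothesis dom : forall x y, mdist x y <= mdist (f x) (f y).

Lemma dominating_inj : injective f.
Proof.
move=> x y fxy; apply/eqP; rewrite -[_ == _]negbK -mdist_gt0 -leNgt.
by rewrite (le_trans (dom x y))// fxy mdistxx.
Qed.

(* Vertices outside the image of f are skipped; the walk is allowed to start at
   any w, as it may have just left the image. *)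
Lemma walk_pullback (x y : X) (w : Y) (s : seq Y) : last w s = f y ->
  exists s', [/\ last x s' = y,
    forall z, f z \in s -> z \in s' &
    walk_length x s' <= mdist (f x) w + walk_length w s].
Proof.
elim: s x w => [|v s IH] x w /= lasty.
  exists [:: y]; split=> //.
  rewrite walk_length_cons lasty lerD//.
  by rewrite /walk_length !big_ord0.
have [[z vz]|nim] := pselect (exists z, v = f z).
  have [s' [last' mem' len']] := IH z v lasty.
  exists (z :: s'); split=> // [u|].
    rewrite !inE => /orP[|/mem' ->]; last by rewrite orbT.
    by rewrite vz => /eqP/dominating_inj ->; rewrite eqxx.
  rewrite !walk_length_cons addrA lerD//; last first.
    by move: len'; rewrite vz mdistxx add0r.
  by apply: le_trans (dom _ _) _; rewrite -vz metric_triangle.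
have [s' [last' mem' len']] := IH x v lasty.
exists s'; split=> // [u|].
  rewrite inE => /orP[/eqP fu|/mem' //].
  by case: nim; exists u.
apply: le_trans len' _.
by rewrite walk_length_cons addrA lerD2r metric_triangle.
Qed.

(** Pull back an optimal tour with [w := f x], so that the extra term of [walk_pullback]
    vanishes. *)
Lemma tsp_dominating x C y : tsp x C y <= tsp (f x) (f @: C) (f y).
Proof.
have [[s [lasty sub] <-] _] := tsp_min (f x) (f @: C) (f y).
have [s' [last' mem' len']] := walk_pullback x lasty.
rewrite mdistxx add0r in len'; apply: le_trans len'; apply: tsp_le; split=> //.
apply/fintype.subsetP => c cC; rewrite inE.
have := fintype.subsetP sub (f c) (imset_f f cC).
by rewrite inE => /orP[/eqP/dominating_inj ->|/mem' ->]; rewrite ?eqxx ?orbT.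
Qed.

End Dominating.

(** One optimal tour in [X] is mapped by every [f i], and the averaged bound is applied edge by
    edge. *)
Lemma tsp_stochastic X k (p : 'I_k -> R) (Y : 'I_k -> finMetricType R)
    (f : forall i, X -> Y i) D x (C : {set X}) y :
  (forall i, 0 <= p i) ->
  (forall x y, \sum_i p i * mdist (f i x) (f i y) <= D * mdist x y) ->
  \sum_i p i * tsp (f i x) (f i @: C) (f i y) <= D * tsp x C y.
Proof.
move=> p0 up; have [[s st <-] _] := tsp_min x C y.
rewrite walk_length_sum mulr_sumr.
apply: (@le_trans _ _ (\sum_i p i * walk_length (f i x) (map (f i) s))).
  by apply: ler_sum => i _; rewrite ler_wpM2l// tsp_le//; exact: is_tour_map.
under eq_bigr do rewrite walk_length_map mulr_sumr.
by rewrite exchange_big/=; apply: ler_sum.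
Qed.

End TspMaps.

(** * Symmetric differences and positivity of the lamplighter metric *)

Lemma in_symdiff (T : finType) (A B : {set T}) z :
  (z \in symdiff A B) = ((z \in A) != (z \in B)).
Proof. by rewrite !inE; case: (z \in A); case: (z \in B). Qed.

Lemma symdiff_imset (T U : finType) (f : T -> U) (A B : {set T}) :
  injective f -> symdiff (f @: A) (f @: B) = f @: symdiff A B.
Proof.
move=> f_inj; apply/setP => w; rewrite in_symdiff.
have [[z ->]|nim] := pselect (exists z, w = f z).
  by rewrite !mem_imset// in_symdiff.
have notin (C : {set T}) : (w \in f @: C) = false.
  by apply/negbTE/imsetP => -[z _ wz]; apply: nim; exists z.
by rewrite !notin.
Qed.

Lemma symdiff_eq0 (T : finType) (A B : {set T}) :
  (symdiff A B == finset.set0) = (A == B).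
Proof.
apply/eqP/eqP => [AB|->]; last by apply/setP => z; rewrite in_symdiff inE eqxx.
by apply/setP => z; apply/eqP; rewrite -[_ == _]negbK -in_symdiff AB inE.
Qed.

Section Lamplighter.
Context {R : realType} {X : finMetricType R}.
Implicit Types a b : {set X} * X.

Lemma La_dist_ge0 a b : 0 <= La_dist a b.
Proof. by rewrite addr_ge0 ?tsp_ge0. Qed.

Lemma La_distxx a : La_dist a a = 0.
Proof.
have /eqP aa : symdiff a.1 a.1 == finset.set0 by rewrite symdiff_eq0.
by rewrite /La_dist aa tsp0 cards0 addr0.
Qed.

Lemma La_dist_gt0 a b : a != b -> 0 < La_dist a b.
Proof.
move=> ab; have [abE|abN] := eqVneq a.1 b.1; last first.
  by rewrite ltr_wpDl ?tsp_ge0// ltr0n card_gt0 symdiff_eq0.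
rewrite ltr_wpDr// (lt_le_trans _ (tsp_ge_mdist _ _ _))// mdist_gt0.
apply: contra ab => /eqP ab2.
by rewrite [a]surjective_pairing [b]surjective_pairing abE ab2.
Qed.

End Lamplighter.

(** * Cut metrics on finite sets *)

Section CutMetric.
Context {R : realType}.
Implicit Types M N : finType.

Definition cut_dist M (c : {set M} -> R) (x y : M) : R :=
  \sum_(S : {set M} | (x \in S) != (y \in S)) c S.

Definition cut_metric M (d : M -> M -> R) : Prop :=
  exists2 c : {set M} -> R, forall S, 0 <= c S & d =2 cut_dist c.

Lemma cut_metric_ext M (d d' : M -> M -> R) :
  d =2 d' -> cut_metric d -> cut_metric d'.
Proof. by move=> dd' [c c0 dc]; exists c => // x y; rewrite -dd' dc. Qed.

Lemma cut_metric_cut M (S : {set M}) :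
  cut_metric (fun x y => ((x \in S) != (y \in S))%:R).
Proof.
exists (fun T => (T == S)%:R) => [T|x y]; first exact: ler0n.
rewrite /cut_dist big_mkcond (bigD1 S)//= big1 ?addr0 ?eqxx.
  by case: ifP.
by move=> T /negPf->; case: ifP.
Qed.

Lemma cut_metricZ M (d : M -> M -> R) a :
  0 <= a -> cut_metric d -> cut_metric (fun x y => a * d x y).
Proof.
move=> a0 [c c0 dc]; exists (fun S => a * c S) => [S|x y].
  exact: mulr_ge0.
by rewrite dc /cut_dist mulr_sumr.
Qed.

Lemma cut_metricD M (d d' : M -> M -> R) :
  cut_metric d -> cut_metric d' -> cut_metric (fun x y => d x y + d' x y).
Proof.
move=> [c c0 dc] [c' c'0 d'c']; exists (fun S => c S + c' S) => [S|x y].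
  exact: addr_ge0.
by rewrite dc d'c' /cut_dist big_split.
Qed.

Lemma cut_metric_sum M (I : Type) (r : seq I) (d : I -> M -> M -> R) :
  (forall i, cut_metric (d i)) -> cut_metric (fun x y => \sum_(i <- r) d i x y).
Proof.
move=> dc; elim: r => [|i r IH].
  exists (fun=> 0) => // x y; rewrite big_nil /cut_dist big1//.
apply: cut_metric_ext (cut_metricD (dc i) IH) => x y /=.
by rewrite big_cons.
Qed.

(** [S] separates [h x] from [h y] exactly when its preimage separates [x] from [y], so a cut of [M]
    inherits the total weight of the cuts having it as preimage. *)
Lemma cut_metric_preim M N (h : M -> N) (d : N -> N -> R) :
  cut_metric d -> cut_metric (fun x y => d (h x) (h y)).
Proof.
move=> [c c0 dc].
exists (fun T : {set M} => \sum_(S : {set N} | h @^-1: S == T) c S) => [T|x y].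
  exact: sumr_ge0.
rewrite dc /cut_dist.
rewrite (partition_big (fun S : {set N} => h @^-1: S)
  (fun T : {set M} => (x \in T) != (y \in T)))/=.
  apply: eq_bigr => T xyT; apply: eq_bigl => S.
  apply/andP/idP => [[] //|/eqP ST]; split; last exact/eqP.
  by move: xyT; rewrite -ST !inE.
by move=> S; rewrite !inE.
Qed.

Lemma sum_cards M (A : {set M}) : #|A|%:R = \sum_z (z \in A)%:R :> R.
Proof.
rewrite -sum1_card natr_sum [LHS]big_mkcond; apply: eq_bigr => z _.
by case: ifP.
Qed.

(** This is the Hamming metric: every point [z] contributes the cut of the sets containing [z]. *)
Lemma cut_metric_symdiff M :
  cut_metric (fun A B : {set M} => #|symdiff A B|%:R).
Proof.
apply: (@cut_metric_ext _
    (fun A B => \sum_(z : M) ((A \in [set C : {set M} | z \in C]%SET)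
      != (B \in [set C : {set M} | z \in C]%SET))%:R)).
  move=> A B; rewrite sum_cards; apply: eq_bigr => z _.
  by rewrite in_symdiff !inE.
by apply: cut_metric_sum => z; exact: cut_metric_cut.
Qed.

(** A multiple of the discrete metric, itself a cut metric, is compared with [d]; this serves the
    case of an infinite supremum. *)
Lemma finite_cut_metric M (d : M -> M -> R) :
  (forall x, d x x = 0) -> (forall x y, x != y -> 0 < d x y) ->
  exists K d', cut_metric d' /\ forall x y, d x y <= d' x y <= K * d x y.
Proof.
move=> d0 dgt0.
have dge0 x y : 0 <= d x y.
  by have [->|/dgt0/ltW //] := eqVneq x y; rewrite d0.
pose T := \sum_x \sum_y d x y.
(* [T] exceeds every distance and [J] every inverse distance; the diagonal terms of [J] are 0, since
   the inverse of 0 is 0. *)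
pose J := \sum_x \sum_y (d x y)^-1.
have T0 : 0 <= T by apply: sumr_ge0 => x _; exact: sumr_ge0.
have le_sum2 (F : M -> M -> R) x y : (forall x y, 0 <= F x y) ->
    F x y <= \sum_x \sum_y F x y.
  move=> F0; rewrite (bigD1 x)//= (bigD1 y)//= -addrA lerDl.
  by rewrite addr_ge0 ?sumr_ge0// => z _; rewrite ?sumr_ge0.
pose delta (x y : M) := #|symdiff [set x]%SET [set y]%SET|%:R : R.
exists (T * #|M|%:R * J), (fun x y => T * delta x y); split.
  apply: cut_metricZ => //.
  exact: (cut_metric_preim (fun x => [set x]%SET) (cut_metric_symdiff M)).
move=> x y; have [->|xy] := eqVneq x y.
  rewrite d0 mulr0 /delta; have /eqP -> : symdiff [set y]%SET [set y]%SET
    == finset.set0 by rewrite symdiff_eq0.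
  by rewrite cards0 mulr0 lexx.
have delta1 : 1 <= delta x y.
  rewrite ler1n card_gt0 symdiff_eq0; apply: contra xy => /eqP/setP/(_ x).
  by rewrite !inE eqxx => /esym.
apply/andP; split.
  apply: le_trans (le_sum2 d x y dge0) _.
  by rewrite -/T ler_peMr.
rewrite -!mulrA ler_wpM2l//; apply: (@le_trans _ _ (#|M|%:R * 1)).
  by rewrite mulr1 ler_nat max_card.
rewrite ler_wpM2l// mulrC -ler_pdivrMl ?dgt0// mulr1.
by apply: (le_sum2 (fun x y => (d x y)^-1)) => u v; rewrite invr_ge0.
Qed.

End CutMetric.

(** * Compactness of bounded cut weights *)

Section Compactness.
Import ArrowAsProduct.
Context {R : realType} {M : finType}.

Lemma continuous_cut_dist (x y : M) :
  continuous (fun c : {set M} -> R => cut_dist c x y).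
Proof.
rewrite /cut_dist; apply: continuous_big; first exact: add_continuous.
by move=> S _; exact: (@proj_continuous _ (fun=> R) S).
Qed.

(** Weights for the errors [n.+1%:R^-1] lie in a box, compact by Tychonoff; a cluster point inherits
    the inequalities because they are closed conditions. *)
Lemma cut_metric_limit (d : M -> M -> R) (K : R) :
  (forall x y, 0 <= d x y) ->
  (forall e, 0 < e -> exists2 d' : M -> M -> R, cut_metric d' &
    forall x y, d x y <= d' x y <= (K + e) * d x y) ->
  exists2 d' : M -> M -> R, cut_metric d' &
    forall x y, d x y <= d' x y <= K * d x y.
Proof.
move=> d0 approx.
pose sep (S : {set M}) := [exists x, exists y, (x \in S) != (y \in S)].
(* A cut separating [x] from [y] weighs at most [(K + 1) * d x y]; summing over all pairs bounds all
   nontrivial cuts at once. *)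
pose B := \sum_x \sum_y (K + 1) * d x y.
have /choice[c cP] (n : nat) : exists c : {set M} -> R,
    (forall S, 0 <= c S <= B) /\
    forall x y, d x y <= cut_dist c x y <= (K + n.+1%:R^-1) * d x y.
  have [|d' [c c0 d'c] d'P] := approx n.+1%:R^-1; first by rewrite invr_gt0.
  have cut_le x y (S : {set M}) : (x \in S) != (y \in S) ->
      c S <= (K + 1) * d x y.
    move=> xyS; apply: (@le_trans _ _ (cut_dist c x y)).
      by rewrite /cut_dist (bigD1 S)//= lerDl sumr_ge0.
    rewrite -d'c; have /andP[_ /le_trans] := d'P x y; apply.
    by rewrite ler_wpM2r// lerD2l invf_le1// ler1n.
  have d1 x y : 0 <= (K + 1) * d x y.
    have /andP[dd' /(le_trans dd')] := d'P x y.
    move=> /(le_trans (d0 x y))/le_trans; apply.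
    by rewrite ler_wpM2r// lerD2l invf_le1// ler1n.
  (* Trivial cuts carry no information but could have unbounded weight. *)
  exists (fun S => if sep S then c S else 0); split=> [S|x y].
    case: ifPn => [/existsP[x /existsP[y xyS]]|_].
      rewrite c0/= (le_trans (cut_le x y S xyS))//.
      rewrite /B (bigD1 x)//= (bigD1 y)//= -addrA lerDl.
      by rewrite addr_ge0 ?sumr_ge0// => z _; rewrite ?sumr_ge0.
    by rewrite lexx; apply: sumr_ge0 => x _; exact: sumr_ge0.
  have := d'P x y; rewrite d'c (_ : cut_dist _ x y = cut_dist c x y)//.
  apply: eq_bigr => S xyS; rewrite (_ : sep S)//.
  by apply/existsP; exists x; apply/existsP; exists y.
have := @tychonoff {set M} (fun=> R) (fun=> `[0, B]%classic)
  (fun=> @segment_compact _ _ _).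
have c_box : \forall n \near \oo, forall S, `[0, B]%classic (c n S).
  by apply: nearW => n S; rewrite /= in_itv/=; have [] := cP n.
move=> /(_ (c @ \oo) _ c_box)[l [l_box l_cluster]].
have closed_limit (x y : M) (A : set R) : closed A ->
    (\forall n \near \oo, A (cut_dist (c n) x y)) -> A (cut_dist l x y).
  move=> clA cA.
  have clA' : closed ((fun c : {set M} -> R => cut_dist c x y) @^-1` A).
    by apply: preimage_closed => // ? _; exact: continuous_cut_dist.
  by apply: clA' => V lV; apply: l_cluster lV.
exists (cut_dist l).
  by exists l => // S; have := l_box S; rewrite /= in_itv/= => /andP[].
move=> x y; apply/andP; split.
  apply: (closed_limit x y [set r | d x y <= r]); first exact: closed_ge.
  by apply: nearW => n; have /andP[] := (cP n).2 x y.
(* The upper bound varies with [n]; a slack [e] gives a fixed closed set containing the sequence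
   eventually. *)
apply/ler_addgt0Pr => e e0.
apply: (closed_limit x y [set r | r <= K * d x y + e]); first exact: closed_le.
(* [d x y] may be 0, hence the division by [d x y + 1]. *)
have d1 : 0 < d x y + 1 by rewrite ltr_wpDl.
have e1 : 0 < e / (d x y + 1) by rewrite divr_gt0.
near=> n; have /andP[_ /le_trans] := (cP n).2 x y; apply.
rewrite mulrDl lerD2l.
apply: (@le_trans _ _ (n.+1%:R^-1 * (d x y + 1))).
  by rewrite ler_wpM2l ?invr_ge0// lerDl.
rewrite -ler_pdivlMr// ltW//; near: n.
exact: (near_infty_natSinv_lt (PosNum e1)).
Unshelve. all: by end_near.
Qed.

End Compactness.

(** * L_1 distances, and the passage from maps into L_1 to cuts *)

Section L1Basics.
Context {R : realType}.
Local Notation mu := (lebesgue01 R).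

Lemma L1_distE (g h : L1 R) :
  L1_dist g h = (\int[mu]_t `|g t - h t|%:E)%E.
Proof. by rewrite /L1_dist Lnorm1. Qed.

Lemma L1_measurable (g : L1 R) : measurable_fun setT (g : _ -> R).
Proof. exact: (@measurable_funPT _ _ _ _ (repr (LebesgueSpace.sort g))). Qed.

End L1Basics.

Section ToCuts.
Context {R : realType} {M : finType}.
Local Notation mu := (lebesgue01 R).
Local Notation leb := (@lebesgue_measure R).

Lemma L1_dist_lty (g h : L1 R) : (L1_dist g h < +oo)%E.
Proof.
have fin (k : L1 R) : mu.-integrable setT (EFin \o k).
  apply/integrableP; split.
    by apply/measurable_EFinP; exact: L1_measurable.
  have : finite_norm mu 1%E k by exact: Lebesgue_finite.
  by rewrite /finite_norm Lnorm1.
have /integrableP[_] := integrableB measurableT (fin g) (fin h).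
by rewrite L1_distE.
Qed.

(** This writes [|f x t - f y t|] as the measure of the heights [u] whose cut at [t] separates [x]
    from [y]. *)
Lemma lebesgue_between (a b : R) :
  leb [set u | (u < a) != (u < b)] = `|a - b|%:E.
Proof.
wlog ab : a b / a <= b => [ab|].
  have [/ab //|/ltW/ab] := leP a b; rewrite distrC => <-.
  by congr lebesgue_measure; apply/seteqP; split=> u /=; rewrite eq_sym.
rewrite (_ : [set _ | _] = `[a, b[%classic).
  rewrite lebesgue_measure_itv/= lte_fin distrC ger0_norm ?subr_ge0//.
  move: ab; rewrite le_eqVlt => /predU1P[->|->]; first by rewrite ltxx subrr.
  by rewrite EFinB.
apply/seteqP; split=> u /=; rewrite in_itv/= leNgt.
  case: (ltP u a) => ua; case: (ltP u b) => ub //=.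
  by move: (lt_le_trans ua ab); rewrite ltNge ub.
by case: (u < a) => //= ->.
Qed.

Section Levels.
Variable f : M -> L1 R.

Let sublevel (x : M) : set (measurableTypeR R * measurableTypeR R) :=
  [set q | q.2 < f x q.1].

Let measurable_sublevel x : measurable (sublevel x).
Proof.
have -> : sublevel x = (fun q => q.2 < f x q.1) @^-1` [set true].
  by apply/seteqP; split=> q /=.
rewrite -[_ @^-1` _]setTI; apply: measurable_fun_ltr => //.
by apply: measurableT_comp => //; exact: L1_measurable.
Qed.

(** The levels partition the plane: [(t, u)] belongs to the cut of those [x] whose graph passes
    above it. *)
Let level (S : {set M}) : set (measurableTypeR R * measurableTypeR R) :=
  [set q | forall x, (q.2 < f x q.1) = (x \in S)].

Let measurable_level S : measurable (level S).
Proof.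
rewrite (_ : level S = \bigcap_(x in [set: M])
    (if x \in S then sublevel x else ~` sublevel x)).
  apply: fin_bigcap_measurable => // x _; case: ifP => _ //.
  exact: measurableC.
apply/seteqP; split=> q /=.
  by move=> qS x _; case: ifP; rewrite -qS /sublevel /=; first done; move=> ->.
move=> qS x; have := qS x Logic.I; case: ifP => _; rewrite /sublevel/=.
  by move=> ->.
by move/negP/negbTE.
Qed.

(** Heights range over the whole line, as the functions may be unbounded. *)
Let P : {measure set _ -> \bar R} := (mu \x leb)%E.

(** The levels of the cuts separating [x] from [y] are disjoint and fill the region between the two
    graphs, whose area is computed by vertical sections. *)
Let level_sum x y :
  (\sum_(S : {set M} | (x \in S) != (y \in S)) P (level S))%E
  = L1_dist (f x) (f y).
Proof.
rewrite bigfs ?index_enum_uniq//; last by move=> S _; rewrite mem_index_enum.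
rewrite -(@measure_fin_bigcup _ _ _ P)//; last first.
  by move=> S T _ _ [q [/= qS qT]]; apply/setP => z; rewrite -qS qT.
rewrite L1_distE; apply: eq_integral => t _ /=.
rewrite -lebesgue_between; congr lebesgue_measure.
apply/seteqP; split=> u /=.
  by rewrite xsectionE => -[S /= xyS]; rewrite /level /= => qS; rewrite !qS.
rewrite xsectionE /= => sep.
exists (finset (fun z => u < f z t)); first by rewrite /= unfold_in !inE.
by move=> z /=; rewrite inE.
Qed.

Lemma L1_cut_metric : cut_metric (fun x y => fine (L1_dist (f x) (f y))).
Proof.
(* The levels of the empty and the full cut have infinite measure, which [fine] sends to 0, but
   these separate no pair; any other level has measure at most the finite L_1 distance of a pair
   that it separates. *)
exists (fun S => fine (P (level S))) => [S|x y]; first exact: fine_ge0.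
rewrite -level_sum /cut_dist -sum_fine//= => S xyS.
rewrite ge0_fin_numE//.
apply: le_lt_trans (L1_dist_lty (f x) (f y)).
rewrite -level_sum (bigD1 S)//= leeDl//.
exact: sume_ge0.
Qed.

End Levels.
End ToCuts.

(** * From cut metrics to maps into L_1 *)

Section FromCuts.
Context {R : realType}.
Local Notation mu := (lebesgue01 R).

(** A point of [L1] is a class of functions evaluated through a chosen representative, so agreement
    with [g] holds only almost everywhere. *)
Lemma L1_of_integrable (g : measurableTypeR R -> R) :
  mu.-integrable setT (EFin \o g) ->
  exists f : L1 R, ae_eq mu setT (f : measurableTypeR R -> R) g.
Proof.
move=> /integrableP[/measurable_EFinP mg ig].
pose gm : {mfun (measurableTypeR R) >-> (measurableTypeR R)} :=
  HB.pack (g : measurableTypeR R -> measurableTypeR R)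
   (@isMeasurableFun.Build _ _ (measurableTypeR R) (measurableTypeR R) g mg).
pose q : {mfun_ mu, (measurableTypeR R) >-> (measurableTypeR R)} := (\pi gm)%qT.
have qg : ae_eq mu setT (q : _ -> R) g.
  have : (repr q == gm %[mod
      {mfun_ mu, (measurableTypeR R) >-> (measurableTypeR R)}])%qT.
    by rewrite reprK.
  by rewrite eqmodE => /asboolP.
have fq : finite_norm mu 1%E (q : _ -> R).
  apply: le_lt_trans ig.
  rewrite Lnorm1 (ge0_ae_eq_integral (g := fun t => `|g t|%:E))//.
  - by apply/measurable_EFinP; exact: measurableT_comp.
  - by apply/measurable_EFinP; exact: measurableT_comp.
  - exact: (@ae_eq_comp _ _ _ mu setT _ _ (fun r : R => `|r|%:E)).
exists (HB.pack_for (L1 R) q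
  (isFinLebesgue.Build _ _ _ _ _ (@lexx _ _ 1%E) q fq)).
exact: qg.
Qed.

Section StepFunctions.
Context {I : finType}.
Implicit Types (i : I) (a : I -> R).

(** The unit interval is cut into equal pieces, half-open so as to be disjoint. *)
Let block i : set (measurableTypeR R) :=
  `[(enum_rank i)%:R / #|I|%:R, (enum_rank i).+1%:R / #|I|%:R[%classic.

Definition step a (t : measurableTypeR R) : R := \sum_i a i * \1_(block i) t.

Let measurable_block i : measurable (block i).
Proof. exact: measurable_itv. Qed.

Let cardI_gt0 i : 0 < #|I|%:R :> R.
Proof. by rewrite ltr0n; apply/card_gt0P; exists i. Qed.

Let block_inj i j t : block i t -> block j t -> i = j.
Proof.
rewrite /block/= !in_itv/= !ler_pdivrMr ?(cardI_gt0 i)//.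
move=> /andP[i1 i2] /andP[j1 j2].
have n0 := cardI_gt0 i; rewrite !ltr_pdivlMr// in i2 j2.
apply/enum_rank_inj/val_inj/anti_leq/andP.
by split; rewrite -ltnS -(ltr_nat R) ?(le_lt_trans i1 j2) ?(le_lt_trans j1 i2).
Qed.

Let mu_block i : mu (block i) = (#|I|%:R^-1)%:E.
Proof.
have n0 := cardI_gt0 i.
have lt_block : (enum_rank i)%:R / #|I|%:R < (enum_rank i).+1%:R / #|I|%:R :> R.
  by rewrite ltr_pM2r ?invr_gt0// ltr_nat.
rewrite /lebesgue01 /= /mrestr setIidl.
  rewrite lebesgue_measure_itv/= lte_fin lt_block -EFinB -mulrBl.
  by rewrite -natrB// subSnn mul1r.
move=> t; rewrite /block/= !in_itv/= => /andP[it ti]; apply/andP; split.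
  by rewrite (le_trans _ it)// divr_ge0.
rewrite (le_trans (ltW ti))// ler_pdivrMr// mul1r ler_nat.
exact: ltn_ord.
Qed.

Lemma measurable_step a : measurable_fun setT (step a).
Proof. by apply: measurable_sum => i; exact: measurable_funM. Qed.

Lemma stepB a b t : step a t - step b t = step (fun i => a i - b i) t.
Proof. by rewrite /step -sumrB; apply: eq_bigr => i _; rewrite mulrBl. Qed.

(** By disjointness at most one term is nonzero at [t]. *)
Lemma norm_step a t : `|step a t| = step (fun i => `|a i|) t.
Proof.
rewrite /step; have [[i it]|no] := pselect (exists i, block i t); last first.
  have out i : \1_(block i) t = 0 :> R.
    by rewrite indicE memNset// => it; apply: no; exists i.
  by rewrite !big1 ?normr0// => i _; rewrite out mulr0.
have out j : j != i -> \1_(block j) t = 0 :> R.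
  by move=> /eqP ji; rewrite indicE memNset// => /block_inj/(_ it).
rewrite (bigD1 i)//= [in RHS](bigD1 i)//= !big1 => [|j /out->|j /out->].
- by rewrite indicE mem_set// !addr0 !mulr1.
- by rewrite mulr0.
- by rewrite mulr0.
Qed.

Lemma integral_step a :
  (\int[mu]_t `|step a t|%:E = (\sum_i `|a i| / #|I|%:R)%:E)%E.
Proof.
under eq_integral do rewrite norm_step /step -sumEFin.
rewrite ge0_integral_sum//; last first.
  by move=> i; apply/measurable_EFinP; exact: measurable_funM.
rewrite -sumEFin; apply: eq_bigr => i _.
under eq_integral do rewrite EFinM.
rewrite ge0_integralZl//; last exact/measurable_EFinP.
by rewrite integral_indic// setIT mu_block.
Qed.

(** Finite-dimensional l_1 embeds isometrically through step functions; the factor [#|I|%:R] offsets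
    the measure of a block. *)
Lemma L1_steps (J : Type) (a : J -> I -> R) : exists f : J -> L1 R,
  forall j k, L1_dist (f j) (f k) = (\sum_i `|a j i - a k i|)%:E.
Proof.
pose g j := step (fun i => a j i * #|I|%:R).
have /choice[f fP] j : exists f : L1 R,
    ae_eq mu setT (f : measurableTypeR R -> R) (g j).
  apply: L1_of_integrable; apply/integrableP; split.
    by apply/measurable_EFinP; exact: measurable_step.
  by rewrite integral_step ltry.
exists f => j k; rewrite L1_distE.
rewrite (ge0_ae_eq_integral (g := fun t => `|g j t - g k t|%:E))//.
- under eq_integral do rewrite stepB.
  rewrite integral_step; congr EFin; apply: eq_bigr => i _.
  by rewrite -mulrBl normrM normr_nat mulfK// gt_eqF// cardI_gt0.
- apply/measurable_EFinP; apply: measurableT_comp => //.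
  by apply: measurable_funB; exact: L1_measurable.
- apply/measurable_EFinP; apply: measurableT_comp => //.
  by apply: measurable_funB; exact: measurable_step.
- apply: (filterS2 _ _ (fP j) (fP k)).
  by move=> t fj fk _; rewrite fj// fk.
Qed.

End StepFunctions.

(** Use one coordinate per cut [S], equal to [c S] on [S] and 0 elsewhere. *)
Lemma cut_metric_L1 (M : finType) (d : M -> M -> R) : cut_metric d ->
  exists f : M -> L1 R, forall x y, L1_dist (f x) (f y) = (d x y)%:E.
Proof.
move=> [c c0 dc]; have [f fP] := L1_steps (fun x S => c S * (x \in S)%:R).
exists f => x y; rewrite fP dc /cut_dist; congr EFin; rewrite [RHS]big_mkcond.
apply: eq_bigr => S _; rewrite -mulrBr normrM ger0_norm//.
case: (x \in S); case: (y \in S); rewrite /= ?subrr ?subr0 ?sub0r.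
all: by rewrite ?normrN ?normr0 ?normr1 ?mulr0 ?mulr1.
Qed.

End FromCuts.

(** * L_1 distortion in terms of cut metrics *)

Section Distortion.
Context {R : realType} {M : finType}.

(** For each [e] the infimum supplies an embedding with constant below [K + e]; divided by its scale
    and turned into cuts, it feeds [cut_metric_limit]. *)
Lemma c1_cut_metric (d : M -> M -> R) (K : R) :
  (forall x y, 0 <= d x y) -> (c1 d <= K%:E)%E ->
  exists2 d' : M -> M -> R, cut_metric d' &
    forall x y, d x y <= d' x y <= K * d x y.
Proof.
move=> d0 c1K; apply: cut_metric_limit => // e e0.
have /ereal_inf_lt[_ [K' [_ [s [f [s0 fP]]]] <-] K'K] :
    (c1 d < (K + e)%:E)%E by rewrite (le_lt_trans c1K)// lte_fin ltrDl.
exists (fun x y => s^-1 * fine (L1_dist (f x) (f y))).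
  by apply: cut_metricZ (L1_cut_metric f); rewrite invr_ge0 ltW.
move=> x y; have := fP x y.
have -> : L1_dist (f x) (f y) = (fine (L1_dist (f x) (f y)))%:E.
  by rewrite fineK// ge0_fin_numE ?L1_dist_lty// L1_distE integral_ge0.
rewrite /= !lee_fin ler_pdivlMl// => /andP[-> /=] fle.
rewrite ler_pdivrMl//; apply: le_trans fle _.
rewrite mulrCA -mulrA ler_wpM2r//; last by rewrite ltW// -lte_fin.
by rewrite mulr_ge0// ltW.
Qed.

Lemma cut_metric_embeds (d d' : M -> M -> R) (K : R) : cut_metric d' ->
  (forall x y, d x y <= d' x y <= K * d x y) -> L1_embeds d K.
Proof.
move=> /cut_metric_L1[f fP] d'P; exists 1, f; split=> // x y.
by rewrite fP !lee_fin mul1r mulr1.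
Qed.

Lemma c1_ge1 (d : M -> M -> R) : (1 <= c1 d)%E.
Proof. by apply: le_ereal_inf_tmp => _ [K [K1 _] <-]; rewrite lee_fin. Qed.

End Distortion.

(** * Averaging cut metrics over the stochastic embedding *)

Section StochasticSum.
Context {R : realType} (X : finMetricType R).
Context (k : nat) (p : 'I_k -> R) (Y : 'I_k -> finMetricType R).
Context (f : forall i, X -> Y i) (D K : R).
Hypothesis p_ge0 : forall i, 0 <= p i.
Hypothesis p_sum : \sum_i p i = 1.
Hypothesis f_dom : forall i x y, mdist x y <= mdist (f i x) (f i y).
Hypothesis f_avg :
  forall x y, \sum_i p i * mdist (f i x) (f i y) <= D * mdist x y.
Hypothesis DK_ge1 : 1 <= D * K.
Hypothesis K_ge0 : 0 <= K.
Hypothesis Ts_cut : forall i, exists2 d : {set Y i} * Y i -> _ -> R,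
  cut_metric d & forall a b, Ts_dist a b <= d a b <= K * Ts_dist a b.

Let push i (a : {set X} * X) : {set Y i} * Y i := (f i @: a.1, f i a.2).

(** Dominating maps are injective, so images commute with symmetric differences. *)
Let Ts_dist_push i a b :
  Ts_dist (push i a) (push i b)
  = tsp (f i a.2) (f i @: symdiff a.1 b.1) (f i b.2).
Proof.
by rewrite /Ts_dist/= symdiff_imset//; exact: dominating_inj (@f_dom i).
Qed.

Lemma La_embeds : L1_embeds (@La_dist R X) (D * K).
Proof.
pose d i := sval (cid2 (Ts_cut i)).
have d_cut i : cut_metric (d i) by rewrite /d; case: cid2.
have dP i a b : Ts_dist a b <= d i a b <= K * Ts_dist a b.
  by rewrite /d; case: cid2 => d' /= _; exact.
pose dLa a b := \sum_i p i * d i (push i a) (push i b) + #|symdiff a.1 b.1|%:R.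
apply: (@cut_metric_embeds _ _ _ dLa).
  apply: cut_metricD; last first.
    exact: (cut_metric_preim fst (cut_metric_symdiff X)).
  apply: cut_metric_sum => i; apply: cut_metricZ => //.
  exact: (cut_metric_preim (push i) (d_cut i)).
move=> a b; rewrite /dLa /La_dist mulrDr; apply/andP; split; rewrite lerD//.
(* As the [p i] sum to 1, the tour length in [X] is its own average and can be compared term by
   term. *)
- rewrite -[leLHS]mul1r -p_sum mulr_suml; apply: ler_sum => i _.
  rewrite ler_wpM2l//; have /andP[+ _] := dP i (push i a) (push i b).
  apply: le_trans; rewrite Ts_dist_push.
  exact: tsp_dominating (@f_dom i) _ _ _.
- rewrite (mulrC D) -mulrA.
  apply: le_trans (ler_wpM2l K_ge0
    (tsp_stochastic a.2 (symdiff a.1 b.1) b.2 p_ge0 f_avg)).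
  rewrite mulr_sumr; apply: ler_sum => i _; rewrite mulrCA ler_wpM2l//.
  by rewrite -Ts_dist_push; have /andP[] := dP i (push i a) (push i b).
(* The cardinality term has coefficient 1, which [DK_ge1] keeps below [D * K]. *)
- by rewrite ler_peMl.
Qed.

End StochasticSum.

Theorem theorem5 (R : realType) (X : finMetricType R)
    (Yc : set (finMetricType R)) (D : R) :
  1 <= D ->
  stochastic_embedding X Yc D ->
  L1_embeds_at_most (@La_dist R X)
    (D%:E * ereal_sup [set c1 (@Ts_dist R Y) | Y in Yc])%E.
Proof.
move=> D1 [k [p [Y [f [k1 [p0 p1] YcY f_dom f_avg]]]]].
have D0 : 0 < D := lt_le_trans ltr01 D1.
set K := ereal_sup _.
have c1K i : (c1 (@Ts_dist R (Y i)) <= K)%E.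
  by apply: ereal_sup_ubound; exists (Y i).
(* Since [k] is positive, some [Y i] witnesses that the supremum is at least 1; this excludes [-oo]
   and yields [1 <= D * K] in the finite case. *)
have : (1 <= K)%E := le_trans (c1_ge1 _) (c1K (Ordinal k1)).
move: c1K; case: K => [K| |] c1K // K1; last first.
  have [K [d [d_cut dP]]] := finite_cut_metric La_distxx (@La_dist_gt0 R X).
  exists K; last exact: cut_metric_embeds d_cut dP.
  by rewrite gt0_muley ?lte_fin// leey.
rewrite lee_fin in K1.
exists (D * K); first by rewrite EFinM.
have K0 : 0 <= K := le_trans ler01 K1.
apply: (La_embeds p0 p1 f_dom f_avg) => // [|i].
  by rewrite (le_trans D1)// ler_peMr// ltW.
by apply: c1_cut_metric (c1K i) => a b; exact: tsp_ge0.
Qed.
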